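(* Let $a>0$, $b\ge0$, $u_0\in\mathbb{R}$, $c>0$, and let $u$ be a solution on the interval $[0,c]$ of $$\frac{u''}{(1+u'^2)^{3/2}}+\frac1r\,\frac{u'}{\sqrt{1+u'^2}}=ar^2+b,\qquad u(0)=u_0,\quad u'(0)=0.$$ Define $$y(r)=R+u_0-\sqrt{R^2-r^2},\qquad R=c\,\frac{\sqrt{1+u'(c)^2}}{u'(c)}.$$ Then $u(r)<y(r)$ for all $0<r\le c$.
   Context: A solution $u=u(r)$ is a $C^2$ function on $[0,c]$ satisfying the differential equation for $r\in(0,c]$ together with the initial conditions at $r=0$. It is the profile curve of a surface of revolution about the $x_3$-axis, $(r\cos\theta,r\sin\theta,u(r))$, whose mean curvature $H$ with respect to the upward normal satisfies $2H=ar^2+b$. The graph of $y$ is a piece of a lower half-circle of radius $R$ with $y(0)=u_0$, $y'(0)=0$, $y'(c)=u'(c)$. *)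

(* Defs.v *)
From Stdlib Require Import Reals.
Local Open Scope R_scope.

(* Derivatives are taken relative to [l, h], hence one-sided at the endpoints.
   When l < h they are unique there, so f1 and f2 are determined on [l, h] by f. *)
Definition C2_on (l h : R) (f f1 f2 : R -> R) : Prop :=
  let I := fun x => l <= x <= h in
  (forall x, I x -> D_in f f1 I x) /\
  (forall x, I x -> D_in f1 f2 I x) /\
  (forall x, I x -> continue_in f2 I x).

(* u1 and u2 stand for u' and u''. The profile curve u generates a surface of
   revolution whose mean curvature H satisfies 2 H = a r^2 + b. *)
Definition is_solution (a b u0 c : R) (u u1 u2 : R -> R) : Prop :=
  C2_on 0 c u u1 u2 /\
  (forall r, 0 < r <= c ->
     u2 r / Rpower (1 + u1 r ^ 2) (3 / 2)
       + 1 / r * (u1 r / sqrt (1 + u1 r ^ 2)) = a * r ^ 2 + b) /\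
  u 0 = u0 /\ u1 0 = 0.

(* p is the slope that the lower half-circle centred on the vertical axis
   has at r = c. *)
Definition circle_radius (c p : R) : R := c * (sqrt (1 + p ^ 2) / p).

Definition lower_half_circle (rho u0 r : R) : R :=
  rho + u0 - sqrt (rho ^ 2 - r ^ 2).

(* Main.v *)
Require Import Defs.
From Stdlib Require Import Reals Lra.
From Coquelicot Require Import Coquelicot.
Local Open Scope R_scope.

(** Write [s = u' / sqrt (1 + u'^2)] for the sine of the inclination angle of
    the profile.  Multiplied by [r], the differential equation says
    [(r s)' = a r^3 + b r], so it integrates once, explicitly:
    [s = a r^3 / 4 + b r / 2] ([sine_of_solution]).  Thus [s / r] is strictly
    increasing, because [a > 0].  Along a circle of radius [R] the sine of
    the inclination is [r / R], and [R] is chosen so that the two sines agree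
    at [r = c].  Hence [s < r / R] on the open interval; as the sine is a
    strictly increasing function of the slope, [u' < y'] there.  Both curves
    start at height [u0], so the mean value theorem gives [u < y].

    The derivatives of a solution at [0] and [c] are one-sided, whereas the
    mean value theorem wants continuity at the endpoints as functions on the
    line.  Composing with the projection [clamp] onto the interval supplies
    that continuity and changes nothing inside. *)

(** * One-sided derivatives and the mean value theorem *)

Definition clamp (l h x : R) : R := Rmax l (Rmin h x).

Lemma clamp_in (l h x : R) : l <= h -> l <= clamp l h x <= h.
Proof.
intros Hlh; unfold clamp, Rmax, Rmin.
repeat destruct Rle_dec; lra.
Qed.

Lemma clamp_id (l h x : R) : l <= x <= h -> clamp l h x = x.
Proof.
intros Hx; unfold clamp, Rmax, Rmin.
repeat destruct Rle_dec; lra.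
Qed.

Lemma clamp_nonexpansive (l h x y : R) :
  Rabs (clamp l h x - clamp l h y) <= Rabs (x - y).
Proof.
unfold clamp, Rmax, Rmin, Rabs.
repeat destruct Rle_dec; repeat destruct Rcase_abs; lra.
Qed.

Lemma continuity_clamp (l h : R) (f : R -> R) :
  l <= h ->
  (forall x, l <= x <= h -> continue_in f (fun x => l <= x <= h) x) ->
  forall x, continuity_pt (fun y => f (clamp l h y)) x.
Proof.
intros Hlh Hf x eps Heps.
destruct (Hf (clamp l h x) (clamp_in l h x Hlh) eps Heps) as [d [Hd Hlim]].
exists d; split; [exact Hd|]; intros y [_ Hy].
destruct (Req_dec (clamp l h x) (clamp l h y)) as [E|E].
- rewrite E; simpl; rewrite Rdist_eq; exact Heps.
- apply Hlim; split.
  + split; [exact (clamp_in l h y Hlh)|exact E].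
  + eapply Rle_lt_trans; [apply clamp_nonexpansive|exact Hy].
Qed.

Lemma is_derive_clamp (l h : R) (f f1 : R -> R) (x : R) :
  l < x < h -> D_in f f1 (fun x => l <= x <= h) x ->
  is_derive (fun y => f (clamp l h y)) x (f1 x).
Proof.
intros Hx Hf; apply is_derive_Reals; intros eps Heps.
destruct (Hf eps Heps) as [d [Hd Hlim]].
assert (Hm : 0 < Rmin d (Rmin (x - l) (h - x))).
{ repeat apply Rmin_glb_lt; lra. }
exists (mkposreal _ Hm); intros k Hk0 Hk; simpl in Hk.
assert (Hkd : Rabs k < d).
{ eapply Rlt_le_trans; [exact Hk|apply Rmin_l]. }
assert (Hki : Rabs k < Rmin (x - l) (h - x)).
{ eapply Rlt_le_trans; [exact Hk|apply Rmin_r]. }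
assert (Hkl := Rlt_le_trans _ _ _ Hki (Rmin_l _ _)).
assert (Hkh := Rlt_le_trans _ _ _ Hki (Rmin_r _ _)).
apply Rabs_def2 in Hkl; apply Rabs_def2 in Hkh.
rewrite !clamp_id by lra.
specialize (Hlim (x + k)); simpl in Hlim; unfold Rdist in Hlim.
replace (x + k - x) with k in Hlim by ring.
apply Hlim; split; [split; lra|exact Hkd].
Qed.

(** The mean value is attained in the open interval; strictness of the final
    inequality depends on that, since the slopes of the two curves coincide
    at both ends of the interval from [0] to [c]. *)
Lemma mean_value_open (f df : R -> R) (l h : R) :
  l < h ->
  (forall x, l < x < h -> is_derive f x (df x)) ->
  (forall x, l <= x <= h -> continuity_pt f x) ->
  exists x, l < x < h /\ f h - f l = df x * (h - l).
Proof.
intros Hlh Hd Hc.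
assert (pr : forall x, l < x < h -> derivable_pt f x).
{ intros x Hx; exists (df x); apply is_derive_Reals, Hd, Hx. }
destruct (MVT f id l h pr (fun x _ => derivable_pt_id x) Hlh Hc) as [x [Hx E]].
{ intros x _; apply derivable_continuous_pt, derivable_pt_id. }
exists x; split; [exact Hx|].
rewrite derive_pt_id in E.
assert (E' : derive_pt f x (pr x Hx) = df x).
{ apply derive_pt_eq_0, is_derive_Reals, Hd, Hx. }
rewrite E' in E; unfold id in E; lra.
Qed.

(** * The sine of the inclination as a function of the slope *)

Definition slope_sine (p : R) : R := p / sqrt (1 + p ^ 2).

(** By the chain rule, the first term of the differential equation is therefore
    the derivative of the sine of the inclination along the profile; positivity
    of this derivative also lets slopes be compared through their sines. *)
Lemma is_derive_slope_sine (p : R) :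
  is_derive slope_sine p (1 / Rpower (1 + p ^ 2) (3 / 2)).
Proof.
assert (Hp : 0 < 1 + p ^ 2) by nra.
assert (Hs := sqrt_lt_R0 _ Hp).
assert (Hss := sqrt_sqrt _ (Rlt_le _ _ Hp)).
replace (3 / 2) with (1 + / 2) by field.
rewrite Rpower_plus, Rpower_1, Rpower_sqrt by exact Hp.
unfold slope_sine; auto_derive.
- simpl in *; repeat split; lra.
- replace (1 + p * (p * 1)) with (1 + p ^ 2) by ring.
  set (s := sqrt (1 + p ^ 2)) in *.
  rewrite <- Hss.
  field_simplify_eq; lra.
Qed.

Lemma slope_sine_increasing (p q : R) : p < q -> slope_sine p < slope_sine q.
Proof.
intros Hpq.
apply (incr_function slope_sine m_infty p_infty
         (fun p => 1 / Rpower (1 + p ^ 2) (3 / 2))); try exact I; auto.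
- intros x _ _; apply is_derive_slope_sine.
- intros x _ _; apply Rdiv_lt_0_compat; [lra|apply exp_pos].
Qed.

Lemma slope_sine_lt_1 (p : R) : slope_sine p < 1.
Proof.
assert (Hp : 0 < 1 + p ^ 2) by nra.
assert (Hs := sqrt_lt_R0 _ Hp).
assert (Hss := sqrt_sqrt _ (Rlt_le _ _ Hp)).
unfold slope_sine; apply Rlt_div_l; nra.
Qed.

(** * Circles *)

(** The ratio in the definition of the radius is a reciprocal sine; the
    circle has, when [p > 0], slope [p] at distance [c] from the axis. *)
Lemma circle_radius_slope_sine (c p : R) :
  slope_sine p <> 0 -> circle_radius c p = c / slope_sine p.
Proof.
intros Hs.
assert (Hq : sqrt (1 + p ^ 2) <> 0).
{ apply Rgt_not_eq, sqrt_lt_R0; nra. }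
assert (Hp : p <> 0).
{ intros E; apply Hs; unfold slope_sine; rewrite E; unfold Rdiv; ring. }
unfold circle_radius, slope_sine; field; auto.
Qed.

Definition circle_slope (rho r : R) : R := r / sqrt (rho ^ 2 - r ^ 2).

Lemma is_derive_lower_half_circle (rho u0 r : R) :
  0 <= r < rho ->
  is_derive (lower_half_circle rho u0) r (circle_slope rho r).
Proof.
intros Hr.
assert (Hd : 0 < rho ^ 2 - r ^ 2) by nra.
assert (Hs := sqrt_lt_R0 _ Hd).
unfold lower_half_circle, circle_slope; auto_derive.
- simpl in *; lra.
- replace (rho * (rho * 1) + - (r * (r * 1))) with (rho ^ 2 - r ^ 2) by ring.
  field; lra.
Qed.

Lemma slope_sine_circle (rho r : R) :
  0 <= r < rho -> slope_sine (circle_slope rho r) = r / rho.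
Proof.
intros Hr.
assert (Hd : 0 < rho ^ 2 - r ^ 2) by nra.
assert (Hs := sqrt_lt_R0 _ Hd).
assert (Hss := sqrt_sqrt _ (Rlt_le _ _ Hd)).
assert (E : sqrt (1 + circle_slope rho r ^ 2) = rho / sqrt (rho ^ 2 - r ^ 2)).
{ apply sqrt_lem_1.
  - nra.
  - apply Rlt_le, Rdiv_lt_0_compat; lra.
  - unfold circle_slope.
    field_simplify_eq; lra. }
unfold slope_sine; rewrite E; unfold circle_slope; field; lra.
Qed.

(** * The profile curve *)

(** This is the first integral of the equation: the function [r s - a r^4 / 4
    - b r^2 / 2] has zero derivative and vanishes at [0]. *)
Lemma sine_of_solution (a b u0 c : R) (u u1 u2 : R -> R) :
  0 < c -> is_solution a b u0 c u u1 u2 ->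
  forall r, 0 < r <= c -> slope_sine (u1 r) = r * (a * r ^ 2 / 4 + b / 2).
Proof.
intros hc [[_ [Hu1 _]] [Hode _]] r Hr.
set (v1 := fun x => u1 (clamp 0 c x)).
assert (Hv1 : forall x, 0 <= x <= c -> v1 x = u1 x).
{ intros x Hx; unfold v1; rewrite clamp_id; auto. }
destruct (mean_value_open
    (fun x => x * slope_sine (v1 x) - (a * x ^ 4 / 4 + b * x ^ 2 / 2))
    (fun _ => 0) 0 r) as [x [_ E]].
- lra.
- intros x Hx.
  assert (Hv : is_derive v1 x (u2 x)).
  { apply is_derive_clamp; [lra|apply Hu1; lra]. }
  assert (Hs := is_derive_comp _ _ _ _ _ (is_derive_slope_sine (v1 x)) Hv).
  assert (Hp : is_derive (fun x => a * x ^ 4 / 4 + b * x ^ 2 / 2) x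
                 (a * x ^ 3 + b * x)).
  { auto_derive; [exact I|field]. }
  assert (HF := is_derive_minus _ _ _ _ _
    (is_derive_mult _ _ _ _ _ (is_derive_id x) Hs Rmult_comm) Hp).
  eapply is_derive_ext; [|eapply (eq_ind _ (is_derive _ x) HF)].
  + intros t; reflexivity.
  + unfold minus, plus, opp, mult, scal, one; simpl; unfold mult; simpl.
    rewrite Hv1 by lra.
    assert (Ho := Hode x ltac:(lra)); fold (slope_sine (u1 x)) in Ho.
    apply (f_equal (Rmult x)) in Ho.
    rewrite Rmult_plus_distr_l in Ho.
    replace (x * (1 / x * slope_sine (u1 x))) with (slope_sine (u1 x)) in Ho
      by (field; lra).
    simpl in *; unfold Rdiv in *; lra.
- intros x _.
  assert (Hv : continuity_pt v1 x).
  { apply continuity_clamp; [lra|].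
    intros y Hy; apply (cont_deriv _ _ _ _ (Hu1 y Hy)). }
  apply continuity_pt_minus.
  + apply continuity_pt_mult; [apply continuity_pt_id|].
    apply (continuity_pt_comp v1 slope_sine); [exact Hv|].
    apply derivable_continuous_pt; eexists.
    apply is_derive_Reals, is_derive_slope_sine.
  + apply derivable_continuous_pt.
    exists (a * x ^ 3 + b * x); apply is_derive_Reals.
    auto_derive; [exact I|field].
- rewrite Hv1 in E by lra.
  apply Rmult_eq_reg_l with r; lra.
Qed.

Theorem theorem5 (a b u0 c : R) (u u1 u2 : R -> R)
  (ha : 0 < a) (hb : 0 <= b) (hc : 0 < c)
  (hu : is_solution a b u0 c u u1 u2) :
  forall r : R, 0 < r <= c ->
    u r < lower_half_circle (circle_radius c (u1 c)) u0 r.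
Proof.
intros r Hr.
assert (Hsine := sine_of_solution _ _ _ _ _ _ _ hc hu).
destruct hu as [[Hu _] [_ [Hu0 _]]].
assert (Hsc := Hsine c ltac:(lra)).
assert (Hs1 := slope_sine_lt_1 (u1 c)).
(* [k] is the curvature of the circle. *)
set (k := a * c ^ 2 / 4 + b / 2) in *.
assert (Hac : 0 < a * c ^ 2) by (apply Rmult_lt_0_compat; nra).
assert (Hk : 0 < k) by (unfold k; lra).
assert (Hrho : circle_radius c (u1 c) = / k).
{ rewrite circle_radius_slope_sine, Hsc; [field; lra|].
  rewrite Hsc; apply Rgt_not_eq, Rmult_lt_0_compat; lra. }
rewrite Hrho.
assert (Hck : c < / k).
{ apply Rmult_lt_reg_r with k; [lra|]; rewrite Rinv_l by lra; lra. }
set (y := lower_half_circle (/ k) u0).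
set (v := fun x => u (clamp 0 c x)).
assert (Hv : forall x, 0 <= x <= c -> v x = u x).
{ intros x Hx; unfold v; rewrite clamp_id; auto. }
destruct (mean_value_open (fun x => y x - v x)
    (fun x => circle_slope (/ k) x - u1 x) 0 r) as [x [Hx E]].
- lra.
- intros x Hx; apply (is_derive_minus y v).
  + apply is_derive_lower_half_circle; lra.
  + apply is_derive_clamp; [lra|apply Hu; lra].
- intros x Hx; apply continuity_pt_minus.
  + apply derivable_continuous_pt; eexists.
    apply is_derive_Reals, is_derive_lower_half_circle; lra.
  + apply continuity_clamp; [lra|].
    intros z Hz; apply (cont_deriv _ _ _ _ (Hu z Hz)).
- assert (Hslope : u1 x < circle_slope (/ k) x).
  { apply Rnot_le_lt; intros Hle.
    (* Comparing sines would give [k <= a x^2 / 4 + b / 2], that is [c <= x]. *)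
    assert (Hle' : slope_sine (circle_slope (/ k) x) <= slope_sine (u1 x)).
    { destruct Hle as [Hlt|<-]; [|apply Rle_refl].
      apply Rlt_le, slope_sine_increasing, Hlt. }
    rewrite slope_sine_circle, Hsine in Hle' by lra.
    replace (x / / k) with (x * k) in Hle' by (field; lra).
    apply Rmult_le_reg_l in Hle'; [|lra].
    assert (Hxc : x ^ 2 < c ^ 2) by nra.
    apply (Rmult_lt_compat_l a) in Hxc; [|exact ha].
    unfold k in Hle'; lra. }
  assert (Hy0 : y 0 = u0).
  { unfold y, lower_half_circle.
    replace ((/ k) ^ 2 - 0 ^ 2) with ((/ k) ^ 2) by ring.
    rewrite sqrt_pow2 by lra; ring. }
  rewrite !Hv, Hu0, Hy0 in E by lra.
  assert (0 < (circle_slope (/ k) x - u1 x) * (r - 0))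
    by (apply Rmult_lt_0_compat; lra).
  lra.
Qed.
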